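(* (i) Let $\gamma:\mathbb{B}\to\mathbb{B}'$ be a Grothendieck transformation between two bivariant theories $\mathbb{B},\mathbb{B}':\mathcal{C}\to\mathcal{A}$ having units, and let $\{(\pi_{\lambda\mu};b_{\lambda\mu}):X_\mu\to X_\lambda\}$ be a projective system of bivariant-class-equipped morphisms (with $b_{\lambda\mu}\in\mathbb{B}(X_\mu\xrightarrow{\pi_{\lambda\mu}}X_\lambda)$). Then the natural transformation $\gamma_*:\mathbb{B}_*\to\mathbb{B}'_*$ induces, by passing to inductive limits, a homomorphism $$\gamma_*^{\mathrm{ind}}:\mathbb{B}_*^{\mathrm{ind}}(X_\infty;\{b_{\lambda\mu}\})\to\mathbb{B}'^{\mathrm{ind}}_*(X_\infty;\{\gamma(b_{\lambda\mu})\}).$$ (ii) Let $\{f_\lambda:Y_\lambda\to X_\lambda\}$ be a fiber-square pro-morphism between two projective systems $\{(\rho_{\lambda\mu};d_{\lambda\mu}):Y_\mu\to Y_\lambda\}$ and $\{(\pi_{\lambda\mu};b_{\lambda\mu}):X_\mu\to X_\lambda\}$ of bivariant-class-equipped morphisms such that $d_{\lambda\mu}=f_\lambda^\star b_{\lambda\mu}$. Then the pushforwards $f_{\lambda*}$ induce homomorphisms $f_{\infty*}$ on the inductive limits, and the following diagram commutes: $$\begin{array}{ccc}\mathbb{B}_*^{\mathrm{ind}}(Y_\infty;\{d_{\lambda\mu}\})&\xrightarrow{\gamma_*^{\mathrm{ind}}}&\mathbb{B}'^{\mathrm{ind}}_*(Y_\infty;\{\gamma(d_{\lambda\mu})\})\\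 f_{\infty*}\downarrow&&\downarrow f_{\infty*}\\ \mathbb{B}_*^{\mathrm{ind}}(X_\infty;\{b_{\lambda\mu}\})&\xrightarrow{\gamma_*^{\mathrm{ind}}}&\mathbb{B}'^{\mathrm{ind}}_*(X_\infty;\{\gamma(b_{\lambda\mu})\}).\end{array}$$ (iii) In the setting of (i), let $\mathbb{B}_*(pt)=\mathbb{B}'_*(pt)$ be a commutative ring $\mathcal{R}$ with unit and assume that the homomorphism $\gamma:\mathbb{B}_*(pt)\to\mathbb{B}'_*(pt)$ is the identity. Let $P=\{p_{\lambda\mu}\}$ be a projective system of non-zero elements $p_{\lambda\mu}\in\mathcal{R}$. Then $\gamma_*^{\mathrm{ind}}$ induces a homomorphism $$\gamma_*^{\mathrm{ind}}:\mathbb{B}_{*,P}^{\mathrm{st.ind}}(X_\infty;\{b_{\lambda\mu}\})\to\mathbb{B}'^{\mathrm{st.ind}}_{*,P}(X_\infty;\{\gamma(b_{\lambda\mu})\})$$ and the triangle $$\chi^{\mathrm{ind}}_{\mathbb{B}'_*}\circ\gamma_*^{\mathrm{ind}}=\chi^{\mathrm{ind}}_{\mathbb{B}_*}:\ \mathbb{B}_{*,P}^{\mathrm{st.ind}}(X_\infty;\{b_{\lambda\mu}\})\to\varinjlim_{\lambda\in\Lambda}\{\times p_{\lambda\mu}:\mathcal{R}\to\mathcal{R}\}$$ commutes.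
   Context: $\mathcal{A}$ is the category of abelian groups; $\mathcal{C}$ is a category (of varieties) with final object $pt$ and fiber squares, with a class of morphisms called proper (closed under composition and base change and containing identities). A bivariant theory $\mathbb{B}$ on $\mathcal{C}$ (Fulton–MacPherson) assigns to each morphism $f:X\to Y$ an abelian group $\mathbb{B}(X\xrightarrow{f}Y)$, with three operations that are homomorphisms of abelian groups (bilinear for products): - products $\bullet:\mathbb{B}(X\xrightarrow{f}Y)\otimes\mathbb{B}(Y\xrightarrow{g}Z)\to\mathbb{B}(X\xrightarrow{gf}Z)$; - pushforwards $f_\star:\mathbb{B}(X\xrightarrow{gf}Z)\to\mathbb{B}(Y\xrightarrow{g}Z)$ for $f:X\to Y$ proper and $g:Y\to Z$; - pullbacks $g^\star:\mathbb{B}(X\xrightarrow{f}Y)\to\mathbb{B}(X'\xrightarrow{f'}Y')$ for a fiber square with $g:Y'\to Y$, $X'=X\times_Y Y'$, $g':X'\to X$, $f':X'\to Y'$. They satisfy seven axioms: (A1) $\bullet$ is associative. (A2) $(gf)_\star=g_\star f_\star$. (A3) $\mathrm{id}^\star=\mathrm{id}$ and $(gh)^\star=h^\star g^\star$. (A12) $f_\star(\alpha\bullet\beta)=f_\star(\alpha)\bullet\beta$ for $\alpha\in\mathbb{B}(X\xrightarrow{gf}Z)$, $\beta\in\mathbb{B}(Z\to W)$, $f$ proper. (A13) For $\alpha\in\mathbb{B}(X\xrightarrow{f}Y)$, $\beta\in\mathbb{B}(Y\xrightarrow{g}Z)$ and $h:Z'\to Z$ with base change $h':Y'=Y\times_Z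 Z'\to Y$: $h^\star(\alpha\bullet\beta)=h'^\star(\alpha)\bullet h^\star(\beta)$. (A23) For $\alpha\in\mathbb{B}(X\xrightarrow{gf}Z)$ with $f:X\to Y$ proper, and $h:Z'\to Z$, with $f'$ the base change of $f$: $f'_\star(h^\star\alpha)=h^\star(f_\star\alpha)$. (A123, projection formula) For a fiber square as in the pullback with $g$ proper, $h:Y\to Z$, $\alpha\in\mathbb{B}(X\xrightarrow{f}Y)$, $\beta\in\mathbb{B}(Y'\xrightarrow{hg}Z)$: $g'_\star(g^\star\alpha\bullet\beta)=\alpha\bullet g_\star\beta$. $\mathbb{B}$ has units if there are $1_X\in\mathbb{B}(X\xrightarrow{\mathrm{id}}X)$ with $\alpha\bullet1_X=\alpha$, $1_X\bullet\beta=\beta$ whenever defined, and $g^\star1_X=1_{X'}$ for $g:X'\to X$. A Grothendieck transformation $\gamma:\mathbb{B}\to\mathbb{B}'$ is a collection of homomorphisms $\mathbb{B}(X\to Y)\to\mathbb{B}'(X\to Y)$ with $\gamma(\alpha\bullet\beta)=\gamma(\alpha)\bullet\gamma(\beta)$, $\gamma(f_\star\alpha)=f_\star\gamma(\alpha)$, $\gamma(g^\star\alpha)=g^\star\gamma(\alpha)$. $\mathbb{B}_*(X):=\mathbb{B}(X\to pt)$ is covariant for proper morphisms via $f_*=f_\star$, and $\gamma_*:\mathbb{B}_*\to\mathbb{B}'_*$ is the induced natural transformation. Whenever a pushforward $f_*$ (or $\chi$ below) is written, the morphism concerned is assumed proper. $\Lambda$ is a directed set. A projective system of bivariant-class-equipped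 morphisms $\{(\pi_{\lambda\mu};b_{\lambda\mu}):X_\mu\to X_\lambda\}$ is a projective system $\{X_\lambda,\pi_{\lambda\mu}\}_{\lambda\in\Lambda}$ in $\mathcal{C}$ with classes $b_{\lambda\mu}\in\mathbb{B}(X_\mu\xrightarrow{\pi_{\lambda\mu}}X_\lambda)$ such that $b_{\lambda\lambda}=1_{X_\lambda}$ and $b_{\mu\nu}\bullet b_{\lambda\mu}=b_{\lambda\nu}$ for $\lambda<\mu<\nu$. $\mathbb{B}_*^{\mathrm{ind}}(X_\infty;\{b_{\lambda\mu}\})$ is the inductive limit of the system $\{\mathbb{B}_*(X_\lambda)\}$ with transition maps $b_{\lambda\mu}\bullet:\mathbb{B}_*(X_\lambda)\to\mathbb{B}_*(X_\mu)$ for $\lambda<\mu$ (identity for $\lambda=\mu$); similarly $\mathbb{B}'^{\mathrm{ind}}_*(X_\infty;\{\gamma(b_{\lambda\mu})\})$ with transition maps $\gamma(b_{\lambda\mu})\bullet$. Here $X_\infty=\varprojlim X_\lambda$ is only notation. A fiber-square pro-morphism $\{f_\lambda:Y_\lambda\to X_\lambda\}_{\lambda\in\Lambda}$ between projective systems $\{Y_\lambda,\rho_{\lambda\mu}\}$ and $\{X_\lambda,\pi_{\lambda\mu}\}$ is a family of morphisms with $\pi_{\lambda\mu}f_\mu=f_\lambda\rho_{\lambda\mu}$ such that each of these squares ($\lambda<\mu$) is a fiber square. For (iii): $\chi_{\mathbb{B}_*}:\mathbb{B}_*(X)\to\mathbb{B}_*(pt)=\mathcal{R}$ is the pushforward along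 $X\to pt$ (similarly $\chi_{\mathbb{B}'_*}$). A projective system $P=\{p_{\lambda\mu}\}$ in $\mathcal{R}$ satisfies $p_{\lambda\lambda}=1$ and $p_{\lambda\mu}p_{\mu\nu}=p_{\lambda\nu}$ for $\lambda<\mu<\nu$. $\mathbb{B}_{*,P}^{\mathrm{st.ind}}(X_\infty;\{b_{\lambda\mu}\})$ is the subgroup of $\mathbb{B}_*^{\mathrm{ind}}(X_\infty;\{b_{\lambda\mu}\})$ of classes $[\alpha_\lambda]$ represented by some $\alpha_\lambda\in\mathbb{B}_*(X_\lambda)$ with $\chi_{\mathbb{B}_*}(b_{\lambda\mu}\bullet\alpha_\lambda)=p_{\lambda\mu}\cdot\chi_{\mathbb{B}_*}(\alpha_\lambda)$ for all $\mu>\lambda$; equivalently the inductive limit of the subgroups of such $\alpha_\lambda$. $\mathbb{B}'^{\mathrm{st.ind}}_{*,P}(X_\infty;\{\gamma(b_{\lambda\mu})\})$ is defined in the same way. $\varinjlim_\lambda\{\times p_{\lambda\mu}:\mathcal{R}\to\mathcal{R}\}$ has all terms $\mathcal{R}$ and transition map from index $\lambda$ to index $\mu$ equal to multiplication by $p_{\lambda\mu}$, and $\chi^{\mathrm{ind}}_{\mathbb{B}_*}$, $\chi^{\mathrm{ind}}_{\mathbb{B}'_*}$ send $[\alpha_\lambda]$ (with $\alpha_\lambda$ such a representative) to the class of $\chi_{\mathbb{B}_*}(\alpha_\lambda)$, respectively $\chi_{\mathbb{B}'_*}(\alpha_\lambda)$, in the $\lambda$-th copy of $\mathcal{R}$.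 *)

(* Defs.v *)
From HB Require Import structures.
From mathcomp Require Import all_boot all_order all_algebra.
From mathcomp Require Import boolp.

Set Implicit Arguments.
Unset Strict Implicit.
Unset Printing Implicit Defensive.

Import Order.TTheory GRing.Theory.
Local Open Scope ring_scope.

Record category := Category {
  cobj :> Type;
  mor : cobj -> cobj -> Type;
  midm : forall X, mor X X;
  mcomp : forall X Y Z, mor Y Z -> mor X Y -> mor X Z;
  mcomp_idl : forall X Y (f : mor X Y), mcomp (midm Y) f = f;
  mcomp_idr : forall X Y (f : mor X Y), mcomp f (midm X) = f;
  mcomp_assoc : forall X Y Z W (f : mor X Y) (g : mor Y Z) (h : mor Z W),
    mcomp h (mcomp g f) = mcomp (mcomp h g) f }.

Arguments mor {c}.
Arguments midm {c}.
Arguments mcomp {c X Y Z}.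

Notation "g \oc f" := (mcomp g f) (at level 50, left associativity).

(* [fiber_square g' f' f g] is the square

       X' --g'--> X
       |f'        |f
       Y' --g---> Y

   with X' a fiber product of X and Y' over Y. *)
Definition fiber_square (C : category) (X' Y' X Y : C)
    (g' : mor X' X) (f' : mor X' Y') (f : mor X Y) (g : mor Y' Y) : Prop :=
  f \oc g' = g \oc f' /\
  forall (T : C) (a : mor T X) (c : mor T Y'), f \oc a = g \oc c ->
    exists! t : mor T X', g' \oc t = a /\ f' \oc t = c.

Record bivariant_category := BivariantCategory {
  bcat :> category;
  pt : bcat;
  to_pt : forall X : bcat, mor X pt;
  to_pt_unique : forall (X : bcat) (f g : mor X pt), f = g;
  has_fiber_squares : forall (X Y' Y : bcat) (f : mor X Y) (g : mor Y' Y),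
    exists (X' : bcat) (g' : mor X' X) (f' : mor X' Y'),
      fiber_square g' f' f g;
  is_proper : forall X Y : bcat, mor X Y -> Prop;
  is_proper_id : forall X : bcat, is_proper (midm X);
  is_proper_comp : forall (X Y Z : bcat) (f : mor X Y) (g : mor Y Z),
    is_proper f -> is_proper g -> is_proper (g \oc f);
  is_proper_base_change : forall (X' Y' X Y : bcat)
    (g' : mor X' X) (f' : mor X' Y') (f : mor X Y) (g : mor Y' Y),
    fiber_square g' f' f g -> is_proper f -> is_proper f' }.

Arguments pt {b}.
Arguments to_pt {b}.
Arguments is_proper {b X Y}.

(* The group of a composite is reached through any morphism [k] together with
   a proof of [g \oc f = k] (take [erefl] for the composite itself).  This
   replaces transports along associativity and unit equations, for instance
   between the groups of [h \oc (g \oc f)] and [(h \oc g) \oc f]. *)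
Record bivariant_theory (C : bivariant_category) := BivariantTheory {
  biv :> forall X Y : C, mor X Y -> zmodType;
  bprod : forall (X Y Z : C) (f : mor X Y) (g : mor Y Z) (k : mor X Z),
    g \oc f = k -> biv f -> biv g -> biv k;
  bpush : forall (X Y Z : C) (f : mor X Y) (g : mor Y Z) (k : mor X Z),
    g \oc f = k -> is_proper f -> {additive biv k -> biv g};
  bpull : forall (X' Y' X Y : C)
    (g' : mor X' X) (f' : mor X' Y') (f : mor X Y) (g : mor Y' Y),
    fiber_square g' f' f g -> {additive biv f -> biv f'};
  bprodDl : forall (X Y Z : C) (f : mor X Y) (g : mor Y Z) (k : mor X Z)
    (e : g \oc f = k) (a1 a2 : biv f) (b : biv g),
    bprod e (a1 + a2) b = bprod e a1 b + bprod e a2 b;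
  bprodDr : forall (X Y Z : C) (f : mor X Y) (g : mor Y Z) (k : mor X Z)
    (e : g \oc f = k) (a : biv f) (b1 b2 : biv g),
    bprod e a (b1 + b2) = bprod e a b1 + bprod e a b2;
  bprodA : forall (X Y Z W : C) (f : mor X Y) (g : mor Y Z) (h : mor Z W)
    (gf : mor X Z) (hg : mor Y W) (k : mor X W)
    (e1 : g \oc f = gf) (e2 : h \oc gf = k)
    (e3 : h \oc g = hg) (e4 : hg \oc f = k)
    (a : biv f) (b : biv g) (c : biv h),
    bprod e2 (bprod e1 a b) c = bprod e4 a (bprod e3 b c);
  bpush_comp : forall (X Y Z W : C) (f : mor X Y) (g : mor Y Z) (h : mor Z W)
    (gf : mor X Z) (hg : mor Y W) (k : mor X W)
    (e1 : g \oc f = gf) (e2 : h \oc gf = k)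
    (e3 : h \oc g = hg) (e4 : hg \oc f = k)
    (pf : is_proper f) (pg : is_proper g) (pgf : is_proper gf) (a : biv k),
    bpush e2 pgf a = bpush e3 pg (bpush e4 pf a);
  bpull_id : forall (X Y : C) (f : mor X Y)
    (s : fiber_square (midm X) f f (midm Y)) (a : biv f), bpull s a = a;
  bpull_comp : forall (X Y X' Y' X'' Y'' : C)
    (f : mor X Y) (f' : mor X' Y') (f'' : mor X'' Y'')
    (g : mor Y' Y) (g' : mor X' X) (h : mor Y'' Y') (h' : mor X'' X')
    (sg : fiber_square g' f' f g) (sh : fiber_square h' f'' f' h)
    (sgh : fiber_square (g' \oc h') f'' f (g \oc h)) (a : biv f),
    bpull sgh a = bpull sh (bpull sg a);
  bpush_prod : forall (X Y Z W : C) (f : mor X Y) (g : mor Y Z) (h : mor Z W)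
    (gf : mor X Z) (hg : mor Y W) (k : mor X W)
    (e1 : g \oc f = gf) (e2 : h \oc gf = k)
    (e3 : h \oc g = hg) (e4 : hg \oc f = k)
    (pf : is_proper f) (a : biv gf) (b : biv h),
    bpush e4 pf (bprod e2 a b) = bprod e3 (bpush e1 pf a) b;
  bpull_prod : forall (X Y Z X' Y' Z' : C)
    (f : mor X Y) (g : mor Y Z) (f' : mor X' Y') (g' : mor Y' Z')
    (h : mor Z' Z) (h' : mor Y' Y) (h'' : mor X' X)
    (k : mor X Z) (k' : mor X' Z')
    (e : g \oc f = k) (e' : g' \oc f' = k')
    (sg : fiber_square h' g' g h) (sf : fiber_square h'' f' f h')
    (sk : fiber_square h'' k' k h) (a : biv f) (b : biv g),
    bpull sk (bprod e a b) = bprod e' (bpull sf a) (bpull sg b);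
  bpush_pull : forall (X Y Z X' Y' Z' : C)
    (f : mor X Y) (g : mor Y Z) (f' : mor X' Y') (g' : mor Y' Z')
    (h : mor Z' Z) (h' : mor Y' Y) (h'' : mor X' X)
    (k : mor X Z) (k' : mor X' Z')
    (e : g \oc f = k) (e' : g' \oc f' = k')
    (sg : fiber_square h' g' g h) (sf : fiber_square h'' f' f h')
    (sk : fiber_square h'' k' k h)
    (pf : is_proper f) (pf' : is_proper f') (a : biv k),
    bpush e' pf' (bpull sk a) = bpull sg (bpush e pf a);
  projection_formula : forall (X Y X' Y' Z : C)
    (f : mor X Y) (f' : mor X' Y') (g : mor Y' Y) (g' : mor X' X)
    (h : mor Y Z) (hg : mor Y' Z) (hf : mor X Z) (k : mor X' Z)
    (s : fiber_square g' f' f g)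
    (e1 : hg \oc f' = k) (e2 : hf \oc g' = k)
    (e3 : h \oc f = hf) (e4 : h \oc g = hg)
    (pg : is_proper g) (pg' : is_proper g') (a : biv f) (b : biv hg),
    bpush e2 pg' (bprod e1 (bpull s a) b) = bprod e3 a (bpush e4 pg b) }.

Arguments bprod {C} b {X Y Z f g k} : rename.
Arguments bpush {C} b {X Y Z f g k} : rename.
Arguments bpull {C} b {X' Y' X Y g' f' f g} : rename.

Record bivariant_units (C : bivariant_category) (B : bivariant_theory C) :=
  BivariantUnits {
  bunit : forall X : C, B X X (midm X);
  bprod_unitr : forall (X Y : C) (f : mor X Y) (e : midm Y \oc f = f)
    (a : B X Y f), bprod B e a (bunit Y) = a;
  bprod_unitl : forall (X Y : C) (f : mor X Y) (e : f \oc midm X = f)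
    (b : B X Y f), bprod B e (bunit X) b = b;
  bpull_unit : forall (X X' : C) (g : mor X' X)
    (s : fiber_square g (midm X') (midm X) g), bpull B s (bunit X) = bunit X' }.

Arguments bunit {C B}.

Record grothendieck_transformation (C : bivariant_category)
    (B B' : bivariant_theory C) := GrothendieckTransformation {
  gtrans :> forall (X Y : C) (f : mor X Y), {additive B X Y f -> B' X Y f};
  gtrans_prod : forall (X Y Z : C) (f : mor X Y) (g : mor Y Z) (k : mor X Z)
    (e : g \oc f = k) (a : B X Y f) (b : B Y Z g),
    gtrans k (bprod B e a b) = bprod B' e (gtrans f a) (gtrans g b);
  gtrans_push : forall (X Y Z : C) (f : mor X Y) (g : mor Y Z) (k : mor X Z)
    (e : g \oc f = k) (pf : is_proper f) (a : B X Z k),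
    gtrans g (bpush B e pf a) = bpush B' e pf (gtrans k a);
  gtrans_pull : forall (X' Y' X Y : C)
    (g' : mor X' X) (f' : mor X' Y') (f : mor X Y) (g : mor Y' Y)
    (s : fiber_square g' f' f g) (a : B X Y f),
    gtrans f' (bpull B s a) = bpull B' s (gtrans f a) }.

Arguments gtrans {C B B'} g {X Y f} : rename.

Section Covariant.
Variables (C : bivariant_category) (B : bivariant_theory C).

Definition bstar (X : C) : zmodType := B X pt (to_pt X).

Lemma to_pt_comp (X Y : C) (f : mor X Y) : to_pt Y \oc f = to_pt X.
Proof. exact: to_pt_unique. Qed.

Definition star_push (X Y : C) (f : mor X Y) (pf : is_proper f) :
  {additive bstar X -> bstar Y} := bpush B (to_pt_comp f) pf.

Definition star_prod (X Y : C) (f : mor X Y) (b : B X Y f) (a : bstar Y) :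
  bstar X := bprod B (to_pt_comp f) b a.

Definition chi (X : C) (pX : is_proper (to_pt X)) :
  {additive bstar X -> bstar pt} := star_push pX.

Lemma star_prod_is_additive (X Y : C) (f : mor X Y) (b : B X Y f) :
  zmod_morphism (star_prod b).
Proof.
have D x y : star_prod b (x + y) = star_prod b x + star_prod b y.
  exact: bprodDr.
by move=> x y; rewrite -{2}(subrK y x) (D (x - y)) addrK.
Qed.

HB.instance Definition _ (X Y : C) (f : mor X Y) (b : B X Y f) :=
  GRing.isZmodMorphism.Build (bstar Y) (bstar X) (star_prod b)
    (star_prod_is_additive b).

End Covariant.

Definition gtrans_star (C : bivariant_category) (B B' : bivariant_theory C)
    (gamma : grothendieck_transformation B B') (X : C) :
  {additive bstar B X -> bstar B' X} := gtrans gamma.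

Record directed_set := DirectedSet {
  dir_disp : Order.disp_t;
  dir_sort :> porderType dir_disp;
  dir_nonempty : exists i : dir_sort, True;
  dir_upper : forall i j : dir_sort, exists k : dir_sort,
    (i <= k)%O /\ (j <= k)%O }.

Record ind_system (I : directed_set) := IndSystem {
  ind_obj :> I -> zmodType;
  ind_tr : forall i j : I, (i <= j)%O -> {additive ind_obj i -> ind_obj j};
  ind_tr_id : forall (i : I) (h : (i <= i)%O) (a : ind_obj i),
    ind_tr h a = a;
  ind_tr_comp : forall (i j k : I) (hij : (i <= j)%O) (hjk : (j <= k)%O)
    (hik : (i <= k)%O) (a : ind_obj i),
    ind_tr hjk (ind_tr hij a) = ind_tr hik a }.

Arguments ind_tr {I} S {i j} : rename.

Section IndLimit.
Variables (I : directed_set) (S : ind_system I).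
Local Open Scope quotient_scope.

Definition lim_rel (x y : {i : I & S i}) : bool :=
  `[< exists (k : I) (hx : (tag x <= k)%O) (hy : (tag y <= k)%O),
        ind_tr S hx (tagged x) = ind_tr S hy (tagged y) >].

Lemma lim_rel_equiv : equiv_class_of lim_rel.
Proof.
split.
- by move=> x; apply/asboolP; exists (tag x), (lexx _), (lexx _).
- move=> x y; apply/asboolP/asboolP => -[k [hx [hy e]]];
    by exists k, hy, hx.
- move=> y x z /asboolP [k [hx [hy e]]] /asboolP [l [hy' [hz e']]].
  apply/asboolP; have [m [hkm hlm]] := dir_upper k l.
  exists m, (le_trans hx hkm), (le_trans hz hlm).
  rewrite -(ind_tr_comp hx hkm) -(ind_tr_comp hz hlm) e -e'.
  by rewrite !(ind_tr_comp _ _ (le_trans hy hkm)).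
Qed.

Canonical lim_equiv := EquivRelPack lim_rel_equiv.

Definition ind_lim := {eq_quot lim_equiv}.
HB.instance Definition _ := Choice.on ind_lim.
HB.instance Definition _ := EqQuotient.on ind_lim.

Definition in_lim (i : I) (a : S i) : ind_lim :=
  \pi_ind_lim (Tagged (fun i => S i) a).

Lemma in_limP (i j : I) (a : S i) (b : S j) :
  in_lim a = in_lim b <->
  exists (k : I) (hi : (i <= k)%O) (hj : (j <= k)%O),
    ind_tr S hi a = ind_tr S hj b.
Proof. by split=> [/eqquotP/asboolP //|h]; apply/eqquotP/asboolP. Qed.

Lemma in_lim_tr (i j : I) (h : (i <= j)%O) (a : S i) :
  in_lim (ind_tr S h a) = in_lim a.
Proof.
by apply/in_limP; exists j, (lexx j), h; rewrite ind_tr_id.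
Qed.

Lemma in_lim_surj (x : ind_lim) : exists (i : I) (a : S i), x = in_lim a.
Proof. by exists (tag (repr x)), (tagged (repr x)); rewrite /in_lim taggedK reprK. Qed.

Lemma in_lim_above (j : I) (x : ind_lim) :
  exists (i : I) (_ : (j <= i)%O) (a : S i), x = in_lim a.
Proof.
have [i [a ->]] := in_lim_surj x; have [k [hj hi]] := dir_upper j i.
by exists k, hj, (ind_tr S hi a); rewrite in_lim_tr.
Qed.

Definition lim_zero : ind_lim :=
  let: exist i _ := cid (dir_nonempty I) in in_lim (0 : S i).

Definition lim_opp (x : ind_lim) : ind_lim := in_lim (- tagged (repr x)).

Definition lim_add (x y : ind_lim) : ind_lim :=
  let: exist k (conj hx hy) :=
    cid (dir_upper (tag (repr x)) (tag (repr y))) in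
  in_lim (ind_tr S hx (tagged (repr x)) + ind_tr S hy (tagged (repr y))).

Lemma lim_zeroE (i : I) : lim_zero = in_lim (0 : S i).
Proof.
rewrite /lim_zero; case: cid => j _.
have [k [hj hi]] := dir_upper j i.
by apply/in_limP; exists k, hj, hi; rewrite !raddf0.
Qed.

Lemma lim_oppE (i : I) (a : S i) : lim_opp (in_lim a) = in_lim (- a).
Proof.
have : in_lim (tagged (repr (in_lim a))) = in_lim a.
  by rewrite /in_lim taggedK reprK.
move=> /in_limP [k [hj [hi e]]].
by apply/in_limP; exists k, hj, hi; rewrite !raddfN /= e.
Qed.

Lemma lim_addE (i : I) (a b : S i) :
  lim_add (in_lim a) (in_lim b) = in_lim (a + b).
Proof.
have ea : in_lim (tagged (repr (in_lim a))) = in_lim a.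
  by rewrite /in_lim taggedK reprK.
have eb : in_lim (tagged (repr (in_lim b))) = in_lim b.
  by rewrite /in_lim taggedK reprK.
rewrite /lim_add; case: cid => k [h1 h2] /=.
move: (repr (in_lim a)) (repr (in_lim b)) ea eb h1 h2.
move=> [u a'] [v b'] /= ea eb h1 h2.
move: ea eb; rewrite -(in_lim_tr h1) -(in_lim_tr h2).
move: (ind_tr S h1 a') (ind_tr S h2 b') => a1 b1.
move=> /in_limP [p [hp1 [hp2 ea]]] /in_limP [q [hq1 [hq2 eb]]].
have [m [hpm hqm]] := dir_upper p q.
apply/in_limP; exists m, (le_trans hp1 hpm), (le_trans hp2 hpm).
rewrite !raddfD; congr (_ + _).
  by rewrite -(ind_tr_comp hp1 hpm) -(ind_tr_comp hp2 hpm) ea.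
by rewrite -(ind_tr_comp hq1 hqm) eb; apply: ind_tr_comp.
Qed.

Lemma lim_addA : associative lim_add.
Proof.
move=> x y z; have [i [a ->]] := in_lim_surj x.
have [j [hij [b ->]]] := in_lim_above i y.
have [k [hjk [c ->]]] := in_lim_above j z.
rewrite -(in_lim_tr (le_trans hij hjk) a) -(in_lim_tr hjk b).
by rewrite !lim_addE addrA.
Qed.

Lemma lim_addC : commutative lim_add.
Proof.
move=> x y; have [i [a ->]] := in_lim_surj x.
have [j [hij [b ->]]] := in_lim_above i y.
by rewrite -(in_lim_tr hij a) !lim_addE addrC.
Qed.

Lemma lim_add0 : left_id lim_zero lim_add.
Proof.
by move=> x; have [i [a ->]] := in_lim_surj x; rewrite (lim_zeroE i) lim_addE add0r.
Qed.

Lemma lim_addN : left_inverse lim_zero lim_opp lim_add.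
Proof.
move=> x; have [i [a ->]] := in_lim_surj x.
by rewrite lim_oppE lim_addE addNr -lim_zeroE.
Qed.

HB.instance Definition _ :=
  GRing.isZmodule.Build ind_lim lim_addA lim_addC lim_add0 lim_addN.

Lemma in_lim_is_additive (i : I) : zmod_morphism (@in_lim i).
Proof.
by move=> a b; rewrite -lim_addE -lim_oppE.
Qed.

HB.instance Definition _ (i : I) :=
  GRing.isZmodMorphism.Build (S i) ind_lim (@in_lim i) (@in_lim_is_additive i).

End IndLimit.

Arguments in_lim {I} S {i} a.

Record proj_system (C : category) (I : directed_set) := ProjSystem {
  ps_obj :> I -> C;
  ps_map : forall i j : I, (i <= j)%O -> mor (ps_obj j) (ps_obj i);
  ps_map_id : forall (i : I) (h : (i <= i)%O), ps_map h = midm (ps_obj i);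
  ps_map_comp : forall (i j k : I)
    (hij : (i <= j)%O) (hjk : (j <= k)%O) (hik : (i <= k)%O),
    ps_map hij \oc ps_map hjk = ps_map hik }.

Arguments ps_map {C I} X {i j} : rename.

(* Since a Grothendieck transformation need not preserve units, the classes
   gamma(b_{i j}) satisfy the condition for i < j < k only; the requirement
   b_{i i} = 1 is added in [equipped_classes]. *)
Record mult_classes (C : bivariant_category) (B : bivariant_theory C)
    (I : directed_set) (X : proj_system C I) := MultClasses {
  cls : forall (i j : I) (h : (i <= j)%O), B (X j) (X i) (ps_map X h);
  cls_comp : forall (i j k : I)
    (hij : (i < j)%O) (hjk : (j < k)%O) (hik : (i < k)%O),
    bprod B (ps_map_comp X (ltW hij) (ltW hjk) (ltW hik))
      (cls (ltW hjk)) (cls (ltW hij)) = cls (ltW hik) }.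

Arguments cls {C B I X} b {i j} h : rename.

Record equipped_classes (C : bivariant_category) (B : bivariant_theory C)
    (u : bivariant_units B) (I : directed_set) (X : proj_system C I) :=
  EquippedClasses {
  ec_classes :> mult_classes B X;
  ec_unit : forall (i : I) (h : (i <= i)%O),
    ecast f (B (X i) (X i) f) (ps_map_id X h) (cls ec_classes h)
    = bunit u (X i) }.

Definition gtrans_classes (C : bivariant_category) (B B' : bivariant_theory C)
    (gamma : grothendieck_transformation B B') (I : directed_set)
    (X : proj_system C I) (b : mult_classes B X) : mult_classes B' X.
Proof.
exists (fun i j h => gtrans gamma (cls b h)) => i j k hij hjk hik.
by rewrite -gtrans_prod cls_comp.
Defined.

Section BivariantIndLimit.
Variables (C : bivariant_category) (B : bivariant_theory C).
Variables (I : directed_set) (X : proj_system C I) (b : mult_classes B X).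

(* The transition map is the identity for i = j and multiplication by b_{i j}
   for i < j. *)
Definition star_tr (i j : I) (h : (i <= j)%O) (a : bstar B (X i)) :
    bstar B (X j) :=
  match i =P j with
  | ReflectT e => ecast k (bstar B (X k)) e a
  | ReflectF _ => star_prod (cls b h) a
  end.

Lemma star_tr_id (i : I) (h : (i <= i)%O) (a : bstar B (X i)) :
  star_tr h a = a.
Proof. by rewrite /star_tr; case: eqP => // e; rewrite eq_axiomK. Qed.

Lemma star_tr_lt (i j : I) (h : (i < j)%O) (a : bstar B (X i)) :
  star_tr (ltW h) a = star_prod (cls b (ltW h)) a.
Proof.
by rewrite /star_tr; case: eqP => // e; case/eqP: (lt_eqF h).
Qed.

Lemma star_tr_is_additive (i j : I) (h : (i <= j)%O) :
  zmod_morphism (star_tr h).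
Proof.
by rewrite /star_tr; case: (i =P j) => [e|_] x y; [case: j / e h|rewrite raddfB].
Qed.

HB.instance Definition _ (i j : I) (h : (i <= j)%O) :=
  GRing.isZmodMorphism.Build (bstar B (X i)) (bstar B (X j)) (star_tr h)
    (star_tr_is_additive h).

Lemma star_tr_comp (i j k : I) (hij : (i <= j)%O) (hjk : (j <= k)%O)
    (hik : (i <= k)%O) (a : bstar B (X i)) :
  star_tr hjk (star_tr hij a) = star_tr hik a.
Proof.
have [eij|nij] := eqVneq i j.
  by subst j; rewrite star_tr_id (bool_irrelevance hjk hik).
have [ejk|njk] := eqVneq j k.
  by subst k; rewrite star_tr_id (bool_irrelevance hij hik).
have lij : (i < j)%O by rewrite lt_neqAle nij.
have ljk : (j < k)%O by rewrite lt_neqAle njk.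
have lik := lt_trans lij ljk.
rewrite (bool_irrelevance hij (ltW lij)) (bool_irrelevance hjk (ltW ljk)).
rewrite (bool_irrelevance hik (ltW lik)) !star_tr_lt /star_prod.
by rewrite -(cls_comp b lij ljk lik); apply/esym/bprodA.
Qed.

Definition bstar_ind_system : ind_system I :=
  @IndSystem I (fun i => bstar B (X i)) (fun i j h => star_tr h)
    star_tr_id star_tr_comp.

Definition bstar_ind : zmodType := ind_lim bstar_ind_system.

End BivariantIndLimit.

(* A homomorphism satisfying this is unique, by [in_lim_surj]. *)
Definition induces (C : bivariant_category) (B B' : bivariant_theory C)
    (I : directed_set) (X X' : proj_system C I)
    (b : mult_classes B X) (b' : mult_classes B' X')
    (phi : forall i : I, bstar B (X i) -> bstar B' (X' i))
    (Phi : {additive bstar_ind b -> bstar_ind b'}) : Prop :=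
  forall (i : I) (a : bstar B (X i)),
    Phi (in_lim (bstar_ind_system b) a)
    = in_lim (bstar_ind_system b') (phi i a).

Record fs_promorphism (C : bivariant_category) (I : directed_set)
    (Y X : proj_system C I) := FsPromorphism {
  pm_map :> forall i : I, mor (Y i) (X i);
  pm_commute : forall (i j : I) (h : (i <= j)%O),
    ps_map X h \oc pm_map j = pm_map i \oc ps_map Y h;
  pm_square : forall (i j : I) (h : (i < j)%O),
    fiber_square (pm_map j) (ps_map Y (ltW h)) (ps_map X (ltW h)) (pm_map i) }.

Arguments pm_square {C I Y X} f {i j} h : rename.

Record ring_proj_system (R : comPzRingType) (I : directed_set) :=
  RingProjSystem {
  rps :> forall i j : I, (i <= j)%O -> R;
  rps_id : forall (i : I) (h : (i <= i)%O), rps h = 1;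
  rps_comp : forall (i j k : I)
    (hij : (i < j)%O) (hjk : (j < k)%O) (hik : (i < k)%O),
    rps (ltW hij) * rps (ltW hjk) = rps (ltW hik) }.

Arguments rps {R I} p {i j} h : rename.

Section RingIndLimit.
Variables (R : comPzRingType) (I : directed_set) (P : ring_proj_system R I).

Lemma rps_comp_le (i j k : I)
    (hij : (i <= j)%O) (hjk : (j <= k)%O) (hik : (i <= k)%O) :
  rps P hij * rps P hjk = rps P hik.
Proof.
have [eij|nij] := eqVneq i j.
  by subst j; rewrite rps_id mul1r (bool_irrelevance hjk hik).
have [ejk|njk] := eqVneq j k.
  by subst k; rewrite rps_id mulr1 (bool_irrelevance hij hik).
have lij : (i < j)%O by rewrite lt_neqAle nij.
have ljk : (j < k)%O by rewrite lt_neqAle njk.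
have lik := lt_trans lij ljk.
rewrite (bool_irrelevance hij (ltW lij)) (bool_irrelevance hjk (ltW ljk)).
by rewrite (bool_irrelevance hik (ltW lik)) rps_comp.
Qed.

Definition ring_tr (i j : I) (h : (i <= j)%O) (a : R) : R := rps P h * a.

Lemma ring_tr_is_additive (i j : I) (h : (i <= j)%O) :
  zmod_morphism (ring_tr h).
Proof. by move=> x y; rewrite /ring_tr mulrBr. Qed.

HB.instance Definition _ (i j : I) (h : (i <= j)%O) :=
  GRing.isZmodMorphism.Build R R (ring_tr h) (ring_tr_is_additive h).

Definition ring_ind_system : ind_system I.
Proof.
exists (fun=> R) (fun i j h => ring_tr h) => [i h a|i j k hij hjk hik a] /=.
  by rewrite /ring_tr rps_id mul1r.
by rewrite /ring_tr mulrA [rps P hjk * _]mulrC (rps_comp_le _ _ hik).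
Defined.

Definition ring_ind : zmodType := ind_lim ring_ind_system.

End RingIndLimit.

(* The group [bstar B pt] is the commutative ring [R]: an additive bijection
   along which the multiplication of [R] is carried over. *)
Record pt_ring (C : bivariant_category) (B : bivariant_theory C)
    (R : comPzRingType) := PtRing {
  pt_val :> {additive bstar B pt -> R};
  pt_val_bij : bijective pt_val }.

Section StableIndLimit.
Variables (C : bivariant_category) (B : bivariant_theory C).
Variables (I : directed_set) (X : proj_system C I) (b : mult_classes B X).
Variable pX : forall i : I, is_proper (to_pt (X i)).
Variables (R : comPzRingType) (v : pt_ring B R) (P : ring_proj_system R I).

Definition chiR (i : I) (a : bstar B (X i)) : R := v (chi B (pX i) a).

Definition stable (i : I) (a : bstar B (X i)) : Prop :=
  forall (j : I) (h : (i < j)%O),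
    chiR (star_prod (cls b (ltW h)) a) = rps P (ltW h) * chiR a.

Definition st_pred : {pred bstar_ind b} := fun x =>
  `[< exists (i : I) (a : bstar B (X i)),
        stable a /\ x = in_lim (bstar_ind_system b) a >].

Lemma chiR_tr (i j : I) (h : (i <= j)%O) (a : bstar B (X i)) :
  stable a -> chiR (star_tr b h a) = rps P h * chiR a.
Proof.
move=> sa; have [eij|nij] := eqVneq i j.
  by subst j; rewrite star_tr_id rps_id mul1r.
have lij : (i < j)%O by rewrite lt_neqAle nij.
by rewrite (bool_irrelevance h (ltW lij)) star_tr_lt sa.
Qed.

Lemma stable_tr (i j : I) (h : (i <= j)%O) (a : bstar B (X i)) :
  stable a -> stable (star_tr b h a).
Proof.
move=> sa k hk; rewrite chiR_tr // -star_tr_lt.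
rewrite (star_tr_comp b _ _ (le_trans h (ltW hk))) chiR_tr //.
by rewrite mulrA [rps P (ltW hk) * _]mulrC (rps_comp_le _ _ _ (le_trans h (ltW hk))).
Qed.

Lemma chiR_is_additive (i : I) : zmod_morphism (@chiR i).
Proof. by move=> x y; rewrite /chiR !raddfB. Qed.

HB.instance Definition _ (i : I) :=
  GRing.isZmodMorphism.Build (bstar B (X i)) R (@chiR i) (@chiR_is_additive i).

Lemma stable0 (i : I) : stable (0 : bstar B (X i)).
Proof. by move=> j h; rewrite !raddf0 mulr0. Qed.

Lemma stableB (i : I) (x y : bstar B (X i)) :
  stable x -> stable y -> stable (x - y).
Proof. by move=> sx sy j h; rewrite !raddfB /= sx sy mulrBr. Qed.

Lemma st_pred_zmod_closed : zmod_closed st_pred.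
Proof.
split.
  have [i _] := dir_nonempty I; apply/asboolP; exists i, 0.
  by split; [exact: stable0 | rewrite raddf0].
move=> x y /asboolP [i [a [sa ->]]] /asboolP [j [c [sc ->]]].
have [k [hi hj]] := dir_upper i j; apply/asboolP.
exists k, (star_tr b hi a - star_tr b hj c); split.
  by apply: stableB; apply: stable_tr.
rewrite raddfB /=; congr (_ - _).
  exact/esym/(@in_lim_tr _ (bstar_ind_system b)).
exact/esym/(@in_lim_tr _ (bstar_ind_system b)).
Qed.

HB.instance Definition _ :=
  GRing.isZmodClosed.Build (bstar_ind b) st_pred st_pred_zmod_closed.

Record st_ind := StInd {
  st_val :> bstar_ind b;
  _ : st_val \in st_pred }.

HB.instance Definition _ := [isSub for st_val].
HB.instance Definition _ := [Choice of st_ind by <:].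
HB.instance Definition _ := [SubChoice_isSubZmodule of st_ind by <:].

Lemma st_indP (x : st_ind) : exists ia : {i : I & bstar B (X i)},
  stable (tagged ia) /\ st_val x = in_lim (bstar_ind_system b) (tagged ia).
Proof.
by have /asboolP [i [a ?]] := valP x; exists (Tagged (fun i => bstar B (X i)) a).
Qed.

(* The choice of stable representative is immaterial, by [chi_indE]. *)
Definition chi_ind (x : st_ind) : ring_ind P :=
  in_lim (ring_ind_system P) (i := tag (projT1 (cid (st_indP x))))
    (chiR (tagged (projT1 (cid (st_indP x))))).

Lemma chi_indE (x : st_ind) (i : I) (a : bstar B (X i)) :
  stable a -> st_val x = in_lim (bstar_ind_system b) a ->
  chi_ind x = in_lim (ring_ind_system P) (i := i) (chiR a).
Proof.
rewrite /chi_ind; case: cid => -[j c] /= [sc ->] sa.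
move=> /(@in_limP _ (bstar_ind_system b)) [k [hj [hi /= e]]].
apply/in_limP; exists k, hj, hi => /=.
by rewrite /ring_tr -!chiR_tr // e.
Qed.

Lemma chi_ind_is_additive : zmod_morphism chi_ind.
Proof.
move=> x y.
have /asboolP [i [a [sa ex]]] := valP x.
have /asboolP [j [c [sc ey]]] := valP y.
have [k [hi hj]] := dir_upper i j.
have {}ex : st_val x = in_lim (bstar_ind_system b) (star_tr b hi a).
  by rewrite [LHS]ex; apply/esym/(@in_lim_tr _ (bstar_ind_system b)).
have {}ey : st_val y = in_lim (bstar_ind_system b) (star_tr b hj c).
  by rewrite [LHS]ey; apply/esym/(@in_lim_tr _ (bstar_ind_system b)).
have sa' := stable_tr hi sa; have sc' := stable_tr hj sc.
rewrite (chi_indE sa' ex) (chi_indE sc' ey).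
rewrite (@chi_indE (x - y) k (star_tr b hi a - star_tr b hj c)).
- by rewrite !raddfB.
- exact: stableB.
- by rewrite [in RHS]raddfB /= -ex -ey; exact: (GRing.valB x y).
Qed.

HB.instance Definition _ :=
  GRing.isZmodMorphism.Build st_ind (ring_ind P) chi_ind chi_ind_is_additive.

End StableIndLimit.

(* Main.v *)
From HB Require Import structures.
Require Import Defs.
From mathcomp Require Import all_boot all_order all_algebra.
From mathcomp Require Import boolp.

Set Implicit Arguments.
Unset Strict Implicit.
Unset Printing Implicit Defensive.

Import Order.TTheory GRing.Theory.
Local Open Scope ring_scope.

(** Each structural map (the Grothendieck transformation, the proper
pushforward) commutes with the transition maps [b_{ij} •] and hence passes to
the inductive limits: for the transformation by multiplicativity, for the
pushforwards by the projection formula on the squares of the pro-morphism,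
where the classes upstairs are pulled back from those downstairs.  A
transformation that is the identity on the point preserves [chi], hence both
the stability condition and the value of [chi] on a stable representative. *)

(** Bundles a function that is only obtained inside a proof, here by choice or by restriction. *)
Lemma additive_of_zmod_morphism (U V : zmodType) (f : U -> V) :
  zmod_morphism f -> exists g : {additive U -> V}, g =1 f.
Proof.
move=> fB; pose m := GRing.isZmodMorphism.Build U V f fB.
by exists (HB.pack_for {additive U -> V} f m).
Qed.

(** Two representatives of one class agree after transition to a common index, and [phi] carries
    this agreement to [T]. *)
Lemma ind_lim_map (I : directed_set) (S T : ind_system I)
    (phi : forall i : I, {additive S i -> T i}) :
  (forall (i j : I) (h : (i <= j)%O) (a : S i),
      phi j (ind_tr S h a) = ind_tr T h (phi i a)) ->
  exists Phi : {additive ind_lim S -> ind_lim T},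
    forall (i : I) (a : S i), Phi (in_lim S a) = in_lim T (phi i a).
Proof.
move=> phi_tr.
have phi_eq i j (a : S i) (c : S j) :
    in_lim S a = in_lim S c -> in_lim T (phi i a) = in_lim T (phi j c).
  move=> /in_limP [k [hi [hj e]]]; apply/in_limP; exists k, hi, hj.
  by rewrite -!phi_tr e.
(* The value [y] is required to fit every representative of [x], so independence of the
   representative is built into [F]. *)
have /choice [F FE] (x : ind_lim S) : exists y : ind_lim T,
    forall i (a : S i), x = in_lim S a -> y = in_lim T (phi i a).
  have [i [a ->]] := in_lim_surj x.
  by exists (in_lim T (phi i a)) => j c; apply: phi_eq.
have Fin i (a : S i) : F (in_lim S a) = in_lim T (phi i a) by apply: FE.
have FB : zmod_morphism F.
  move=> x y; have [i [a ->]] := in_lim_surj x.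
  have [j [hij [c ->]]] := in_lim_above i y.
  by rewrite -(in_lim_tr hij a) -raddfB !Fin !raddfB.
have [Phi PhiE] := additive_of_zmod_morphism FB.
by exists Phi => i a; rewrite PhiE Fin.
Qed.

(** Compatibility is asked for [i < j] only: at [i = j] the transition is the identity by
    definition, whatever the diagonal class is. *)
Lemma bstar_ind_map (C : bivariant_category) (B B' : bivariant_theory C)
    (I : directed_set) (X X' : proj_system C I)
    (b : mult_classes B X) (b' : mult_classes B' X')
    (phi : forall i : I, {additive bstar B (X i) -> bstar B' (X' i)}) :
  (forall (i j : I) (h : (i < j)%O) (a : bstar B (X i)),
      phi j (star_prod (cls b (ltW h)) a)
      = star_prod (cls b' (ltW h)) (phi i a)) ->
  exists Phi : {additive bstar_ind b -> bstar_ind b'},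
    induces (fun i : I => phi i) Phi.
Proof.
move=> phi_prod.
suff: forall i j (h : (i <= j)%O) a,
    phi j (star_tr b h a) = star_tr b' h (phi i a).
  exact: (@ind_lim_map I (bstar_ind_system b) (bstar_ind_system b') phi).
move=> i j h a; have [eij|nij] := eqVneq i j.
  by subst j; rewrite !star_tr_id.
have lij : (i < j)%O by rewrite lt_neqAle nij.
by rewrite (bool_irrelevance h (ltW lij)) !star_tr_lt.
Qed.

Lemma gtrans_star_prod (C : bivariant_category) (B B' : bivariant_theory C)
    (gamma : grothendieck_transformation B B') (X Y : C) (f : mor X Y)
    (b : B X Y f) (a : bstar B Y) :
  gtrans_star gamma X (star_prod b a)
  = star_prod (gtrans gamma b) (gtrans_star gamma Y a).
Proof. exact: gtrans_prod. Qed.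

(** This is the projection formula with [to_pt Y] as the morphism out of [Y]. *)
Lemma star_push_prod (C : bivariant_category) (B : bivariant_theory C)
    (X Y X' Y' : C) (f : mor X Y) (f' : mor X' Y') (g : mor Y' Y)
    (g' : mor X' X) (s : fiber_square g' f' f g)
    (pg : is_proper g) (pg' : is_proper g') (b : B X Y f) (a : bstar B Y') :
  star_push B pg' (star_prod (bpull B s b) a)
  = star_prod b (star_push B pg a).
Proof. exact: projection_formula. Qed.

(** Stated for [mult_classes], without units, so that it also applies to the images of the classes
    under [gamma]. *)
Lemma fs_push_ind (C : bivariant_category) (B : bivariant_theory C)
    (I : directed_set) (Y X : proj_system C I)
    (d : mult_classes B Y) (b : mult_classes B X)
    (f : fs_promorphism Y X) (pf : forall i : I, is_proper (f i)) :
  (forall (i j : I) (h : (i < j)%O),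
      cls d (ltW h) = bpull B (pm_square f h) (cls b (ltW h))) ->
  exists F : {additive bstar_ind d -> bstar_ind b},
    induces (fun i : I => star_push B (pf i)) F.
Proof.
by move=> db; apply: bstar_ind_map => i j h a; rewrite db star_push_prod.
Qed.

Section Stable.
Variables (C : bivariant_category) (B B' : bivariant_theory C).
Variable gamma : grothendieck_transformation B B'.
Variables (I : directed_set) (X : proj_system C I) (b : mult_classes B X).
Variable pX : forall i : I, is_proper (to_pt (X i)).
Variables (R : comPzRingType) (v : pt_ring B R) (v' : pt_ring B' R).
Variable P : ring_proj_system R I.
Hypothesis gamma_pt : forall a : bstar B pt, v' (gtrans_star gamma pt a) = v a.

(** [chi] is a pushforward to [pt], so [gamma] commutes with it, and [gamma_pt] identifies the two
    values in [R]. *)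
Lemma chiR_gtrans (i : I) (a : bstar B (X i)) :
  chiR pX v' (gtrans_star gamma (X i) a) = chiR pX v a.
Proof.
rewrite /chiR -gamma_pt; congr (v' _).
exact/esym/gtrans_push.
Qed.

Lemma stable_gtrans (i : I) (a : bstar B (X i)) :
  stable b pX v P a ->
  stable (gtrans_classes gamma b) pX v' P (gtrans_star gamma (X i) a).
Proof.
by move=> sa j h; rewrite /= -gtrans_star_prod !chiR_gtrans sa.
Qed.

Lemma st_ind_gtrans
    (g : {additive bstar_ind b -> bstar_ind (gtrans_classes gamma b)}) :
  induces (fun i : I => gtrans_star gamma (X i)) g ->
  exists gst : {additive st_ind b pX v P ->
                         st_ind (gtrans_classes gamma b) pX v' P},
    (forall x : st_ind b pX v P, st_val (gst x) = g (st_val x)) /\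
    (forall x : st_ind b pX v P, chi_ind (gst x) = chi_ind x).
Proof.
move=> gE.
have g_st (x : st_ind b pX v P) :
    g (st_val x) \in st_pred pX v' P.
  have /asboolP [i [a [sa ->]]] := valP x; apply/asboolP.
  by exists i, (gtrans_star gamma (X i) a); split; [exact: stable_gtrans|].
pose G x := StInd (g_st x).
have GB : zmod_morphism G.
  (* Additivity can be checked in the ambient limit, where it is that of [g]. *)
  move=> x y; apply: val_inj; rewrite [RHS]GRing.valB /=.
  by rewrite -raddfB; congr (g _); exact: (GRing.valB x y).
have [gst gstE] := additive_of_zmod_morphism GB.
exists gst; split=> x; rewrite gstE //.
have /asboolP [i [a [sa xa]]] := valP x.
(* The [gamma]-image of a stable representative of [x] is a stable representative of [gst x], so
   [chi_ind] may be computed from it. *)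
rewrite (chi_indE sa xa) -chiR_gtrans; apply: chi_indE.
  exact: stable_gtrans.
by rewrite [LHS]/= [st_val x]xa gE.
Qed.

End Stable.

Theorem theorem1p3 (C : bivariant_category) (B B' : bivariant_theory C)
    (u : bivariant_units B) (u' : bivariant_units B')
    (gamma : grothendieck_transformation B B') (I : directed_set) :
  (* (i) *)
  (forall (X : proj_system C I) (b : equipped_classes u X),
    exists g : {additive bstar_ind b -> bstar_ind (gtrans_classes gamma b)},
      induces (fun i : I => gtrans_star gamma (X i)) g)
  /\
  (* (ii) *)
  (forall (Y X : proj_system C I)
      (d : equipped_classes u Y) (b : equipped_classes u X)
      (f : fs_promorphism Y X) (pf : forall i : I, is_proper (f i)),
    (forall (i j : I) (h : (i < j)%O),
        cls d (ltW h) = bpull B (pm_square f h) (cls b (ltW h))) ->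
    exists (fB : {additive bstar_ind d -> bstar_ind b})
           (fB' : {additive bstar_ind (gtrans_classes gamma d) ->
                            bstar_ind (gtrans_classes gamma b)}),
      [/\ induces (fun i : I => star_push B (pf i)) fB,
          induces (fun i : I => star_push B' (pf i)) fB'
        & forall (gY : {additive bstar_ind d ->
                                 bstar_ind (gtrans_classes gamma d)})
                 (gX : {additive bstar_ind b ->
                                 bstar_ind (gtrans_classes gamma b)}),
            induces (fun i : I => gtrans_star gamma (Y i)) gY ->
            induces (fun i : I => gtrans_star gamma (X i)) gX ->
            forall y : bstar_ind d, fB' (gY y) = gX (fB y)])
  /\
  (* (iii) *)
  (forall (X : proj_system C I) (b : equipped_classes u X)
      (pX : forall i : I, is_proper (to_pt (X i)))
      (R : comPzRingType) (v : pt_ring B R) (v' : pt_ring B' R)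
      (P : ring_proj_system R I),
    (forall a : bstar B pt, v' (gtrans_star gamma pt a) = v a) ->
    (forall (i j : I) (h : (i <= j)%O), rps P h != 0) ->
    forall g : {additive bstar_ind b -> bstar_ind (gtrans_classes gamma b)},
      induces (fun i : I => gtrans_star gamma (X i)) g ->
      exists gst : {additive st_ind b pX v P ->
                             st_ind (gtrans_classes gamma b) pX v' P},
        (forall x : st_ind b pX v P, st_val (gst x) = g (st_val x)) /\
        (forall x : st_ind b pX v P, chi_ind (gst x) = chi_ind x)).
Proof.
split; [|split].
- move=> X b; apply: bstar_ind_map => i j h a; exact: gtrans_star_prod.
- move=> Y X d b f pf db.
  have [fB fBE] := fs_push_ind pf db.
  (* As [gamma] commutes with pullback, the image classes satisfy the same relation, which gives the
     pushforward for [B']. *)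
  have db' i j (h : (i < j)%O) : cls (gtrans_classes gamma d) (ltW h)
      = bpull B' (pm_square f h) (cls (gtrans_classes gamma b) (ltW h)).
    by rewrite /= db gtrans_pull.
  have [fB' fBE'] := fs_push_ind pf db'.
  exists fB, fB'; split=> // gY gX gYE gXE y.
  (* On a representative at index [i], the square says that [gamma] commutes with pushforward along
     [f i]. *)
  have [i [a ->]] := in_lim_surj y.
  rewrite gYE fBE' fBE gXE; congr in_lim.
  exact/esym/gtrans_push.
- move=> X b pX R v v' P gamma_pt _ g gE.
  exact: st_ind_gtrans.
Qed.
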